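(* Let $(V, e)$ be an order unit space with $\dim V \ge 2$. Then $V = \bigcup\{P_u : u \in R_V\}$ in such a way that $\bigcap\{P_u : u \in R_V\} = \mathbb{R} e$, and if $v \in V$ with $v \notin \mathbb{R} e$, then there exists a unique $w \in R_V$ such that $v \in P_w = P_{(e - w)}$.
   Context: Order unit space: a real vector space $V$ with a proper Archimedean cone $V^+$ and an order unit $e \in V^+$ (for each $v \in V$ there is $k > 0$ with $ke \pm v \in V^+$; Archimedean means that $ke + v \in V^+$ for all $k > 0$ implies $v \in V^+$), normed by $\Vert v \Vert = \inf\{k > 0 : ke \pm v \in V^+\}$. The periphery of $V$ is $R_V = \{u \in V^+ : \Vert u \Vert = 1 = \Vert e - u \Vert\}$. For $u \in R_V$, $P_u := \{\alpha e + \beta u : \alpha, \beta \in \mathbb{R}\}$.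
   Formalization: The intersection equals ℝe is claimed only for dim V ≥ 3 (for dim V = 2 every P_u is V, so it fails), and w is unique only up to replacing w by e − w, since e − w ≠ w always also qualifies. *)

(* Defs.v *)
From mathcomp Require Import all_boot all_order all_algebra.
From mathcomp Require Import boolp classical_sets reals.

Set Implicit Arguments.
Unset Strict Implicit.
Unset Printing Implicit Defensive.

Import Order.TTheory GRing.Theory Num.Theory.
Local Open Scope ring_scope.
Local Open Scope classical_set_scope.

(* V is an arbitrary, possibly infinite-dimensional, real vector space, so
   "dim V >= n" is expressed by a linearly independent family of n vectors. *)
Definition lin_indep (R : realType) (V : lmodType R) (n : nat)
    (x : 'I_n -> V) : Prop :=
  forall c : 'I_n -> R, \sum_(i < n) c i *: x i = 0 -> forall i, c i = 0.

Definition dim_ge (R : realType) (V : lmodType R) (n : nat) : Prop :=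
  exists x : 'I_n -> V, lin_indep x.

Record convex_cone (R : realType) (V : lmodType R) (C : set V) : Prop := {
  cone_zero : C 0;
  cone_add : forall u v, C u -> C v -> C (u + v);
  cone_scale : forall (k : R) u, 0 <= k -> C u -> C (k *: u) }.

Record order_unit_space (R : realType) (V : lmodType R) (C : set V) (e : V) :
    Prop := {
  ous_cone : convex_cone C;
  ous_proper : forall v, C v -> C (- v) -> v = 0;
  ous_unit_pos : C e;
  ous_unit : forall v, exists k : R, [/\ 0 < k, C (k *: e + v) & C (k *: e - v)];
  ous_archimedean : forall v, (forall k : R, 0 < k -> C (k *: e + v)) -> C v }.

Definition ounorm (R : realType) (V : lmodType R) (C : set V) (e v : V) : R :=
  inf [set k : R | [/\ 0 < k, C (k *: e + v) & C (k *: e - v)]].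

Definition periphery (R : realType) (V : lmodType R) (C : set V) (e : V) :
    set V :=
  [set u | [/\ C u, ounorm C e u = 1 & ounorm C e (e - u) = 1]].

Definition line (R : realType) (V : lmodType R) (e : V) : set V :=
  [set v | exists a : R, v = a *: e].

Definition plane (R : realType) (V : lmodType R) (e u : V) : set V :=
  [set v | exists a b : R, v = a *: e + b *: u].

(* Main.v *)
Require Import Defs.
From mathcomp Require Import all_boot all_order all_algebra.
From mathcomp Require Import boolp classical_sets reals.
From mathcomp Require Import lra.

(** Off the line [R e], a vector [v] has an optimal order interval
    [m e <= v <= M e]: the Archimedean property makes the bounds attained, and
    properness gives [m < M], since [m = M] would force [v = m e].  The affine
    rescaling [w = (v - m e) / (M - m)] then has optimal interval [0, e], and
    this is exactly what membership in the periphery means (lemma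
    [peripheryP]); so [v = m e + (M - m) w] lies in [plane e w] (lemma
    [exists_periphery]).

    Conversely, an affine change [w = a e + b w'] between two periphery
    elements must carry the optimal interval [0, e] onto itself, so it is the
    identity when [b > 0] and the reflection [w' |-> e - w'] when [b < 0].
    This gives uniqueness up to that reflection (lemma
    [periphery_plane_unique]), which preserves planes.

    Two distinct planes therefore meet only in [R e].  In dimension at least 3
    no single plane exhausts [V], so a vector outside [R e] misses some plane,
    and the intersection of all the planes is [R e]. *)

Set Implicit Arguments.
Unset Strict Implicit.
Unset Printing Implicit Defensive.

Import Order.TTheory GRing.Theory Num.Theory.
Local Open Scope ring_scope.
Local Open Scope classical_set_scope.

(** * Vectors outside a finite span *)

(** Otherwise the coefficients of [n.+1] independent vectors along [y] form a
    matrix with more rows than columns, and a nonzero row vector in its kernel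
    is a linear relation between them. *)
Lemma dim_ge_exists_notin_span (R : realType) (V : lmodType R) (n : nat)
    (y : 'I_n -> V) :
  dim_ge V n.+1 -> exists x : V, ~ exists c : 'I_n -> R, x = \sum_i c i *: y i.
Proof.
move=> [x xfree]; apply: contrapT => noV.
have /choice[A xE] : forall i, exists c : 'I_n -> R, x i = \sum_j c j *: y j.
  by move=> i; apply: contrapT => xi; apply: noV; exists (x i).
pose B : 'M[R]_(n.+1, n) := \matrix_(i, j) A i j.
have /rowV0Pn[c /sub_kermxP cB /eqP c0] : kermx B != 0.
  by rewrite -mxrank_eq0 mxrank_ker -lt0n subn_gt0 ltnS rank_leq_col.
apply: c0; apply/rowP => i; rewrite mxE; apply: (xfree (c 0)).
under eq_bigr => k _ do rewrite xE scaler_sumr.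
rewrite exchange_big big1 // => j _.
under eq_bigr do rewrite scalerA.
rewrite -scaler_suml; have /rowP/(_ j) := cB; rewrite !mxE => cBj.
by under eq_bigr do rewrite -(mxE matrix_key A); rewrite cBj scale0r.
Qed.

Lemma exists_notin_line (R : realType) (V : lmodType R) (e : V) :
  dim_ge V 2 -> exists x, ~ line e x.
Proof.
move=> /(dim_ge_exists_notin_span (fun _ : 'I_1 => e))[x xe].
by exists x => -[a xE]; apply: xe; exists (fun=> a); rewrite big_ord1.
Qed.

Lemma exists_notin_plane (R : realType) (V : lmodType R) (e u : V) :
  dim_ge V 3 -> exists x, ~ plane e u x.
Proof.
move=> /(dim_ge_exists_notin_span (fun i : 'I_2 => if i == 0 then e else u)).
move=> [x xeu]; exists x => -[a [b xE]]; apply: xeu.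
exists (fun i => if i == 0 then a else b).
by rewrite !big_ord_recl big_ord0 addr0.
Qed.

(** * Planes through the order unit *)

Lemma plane_compl_subset (R : realType) (V : lmodType R) (e u : V) :
  plane e (e - u) `<=` plane e u.
Proof.
move=> _ [a [b ->]]; exists (a + b), (- b).
by rewrite scalerBr scaleNr scalerDl addrA.
Qed.

Lemma plane_compl (R : realType) (V : lmodType R) (e u : V) :
  plane e (e - u) = plane e u.
Proof.
apply/seteqP; split; first exact: plane_compl_subset.
by rewrite -{1}[u](subKr e); exact: plane_compl_subset.
Qed.

(** * Optimal bounds by multiples of the order unit *)

Section OrderUnitSpace.
Variables (R : realType) (V : lmodType R) (C : set V) (e : V).
Hypothesis Vous : order_unit_space C e.

Let cone_addC := cone_add (ous_cone Vous).
Let cone_scaleC := cone_scale (ous_cone Vous).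

Lemma cone_unit_comb_le (a b : R) (v : V) :
  a <= b -> C (a *: e + v) -> C (b *: e + v).
Proof.
move=> ab Cv; have : C ((b - a) *: e + (a *: e + v)).
  by apply: cone_addC Cv; apply: cone_scaleC; rewrite ?subr_ge0 //; case: Vous.
by rewrite addrA -scalerDl subrK.
Qed.

Lemma line_of_unit0 (v : V) : e = 0 -> line e v.
Proof.
move=> e0; have [k [_]] := ous_unit Vous v.
rewrite e0 scaler0 !add0r => Cv CNv.
by exists 0; rewrite scaler0; exact: (ous_proper Vous Cv CNv).
Qed.

Lemma cone_unit_scale_ge0 (a : R) : e <> 0 -> C (a *: e) -> 0 <= a.
Proof.
move=> e0 Ca; rewrite leNgt; apply/negP => a0; apply: e0.
apply: (ous_proper Vous); first by case: Vous.
have : C ((- a)^-1 *: (a *: e)).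
  by apply: cone_scaleC Ca; rewrite invr_ge0 oppr_ge0 ltW.
by rewrite scalerA invrN mulNr mulVf ?lt_eqF // scaleN1r.
Qed.

(** The infimum of the admissible [s] is itself admissible: this is where the
    Archimedean property enters. *)
Lemma exists_least_shift (v : V) : e <> 0 ->
  exists m : R, C (m *: e + v) /\ forall s, C (s *: e + v) -> m <= s.
Proof.
move=> e0; pose S : set R := [set s | C (s *: e + v)].
have [k [_ Ck Ck']] := ous_unit Vous v.
have Slb : lbound S (- k).
  move=> s Cs; rewrite -subr_ge0 opprK; apply: (cone_unit_scale_ge0 e0).
  by have := cone_addC Cs Ck'; rewrite addrACA subrr addr0 -scalerDl.
have Sinf : has_inf S by split; [exists k | exists (- k)].
exists (inf S); split=> [|s Cs]; last exact: (ge_inf Sinf.2).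
apply: (ous_archimedean Vous) => d d0.
have [s Ss sd] := inf_adherent d0 Sinf.
by rewrite addrA -scalerDl; apply: cone_unit_comb_le Ss; lra.
Qed.

(** * The periphery *)

Lemma ounorm_eq1P (u : V) : C u ->
  ounorm C e u = 1 <-> C (e - u) /\ (forall t, C (t *: e - u) -> 1 <= t).
Proof.
move=> Cu; rewrite /ounorm; set S := [set k | _].
have CeDu k : 0 <= k -> C (k *: e + u).
  by move=> k0; apply: (cone_unit_comb_le k0); rewrite scale0r add0r.
have Slb : lbound S 0 by move=> k [/ltW].
have Sinf : has_inf S.
  by split; [have [k kS] := ous_unit Vous u; exists k | exists 0].
split=> [S1|[Ceu u1]].
- split=> [|t Ct].
    apply: (ous_archimedean Vous) => d d0.
    have [s [_ _ Ss]] := inf_adherent d0 Sinf; rewrite S1 => sd.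
    rewrite addrA -{2}[e]scale1r -scalerDl.
    by apply: cone_unit_comb_le Ss; lra.
  rewrite leNgt; apply/negP => t1.
  (* The norm only tests positive multiples of the unit, so [t] is first raised
     to a positive number that is still below [1]. *)
  pose s := Num.max t 2^-1.
  have s1 : s < 1 by rewrite /s gt_max t1 /=; lra.
  have s0 : 0 < s by rewrite /s lt_max invr_gt0 ltr0n orbT.
  have Ss : S s.
    split=> //; first exact: CeDu (ltW s0).
    by apply: cone_unit_comb_le Ct; rewrite /s le_max lexx.
  by have := ge_inf Sinf.2 Ss; rewrite S1 leNgt s1.
- apply/eqP; rewrite eq_le; apply/andP; split.
    apply: (ge_inf Sinf.2); split; rewrite ?scale1r //.
    by rewrite -[e]scale1r; exact: CeDu.
  by apply: (lb_le_inf Sinf.1) => t [_ _ /u1].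
Qed.

Lemma unit_scale_sub_compl (t : R) (u : V) :
  t *: e - (e - u) = (t - 1) *: e + u.
Proof. by rewrite opprB addrA addrAC scalerBl scale1r. Qed.

(** The norm conditions say that [0] and [1] are the optimal bounds of [u] by
    multiples of [e]. *)
Lemma peripheryP (u : V) : periphery C e u <->
  [/\ C u, C (e - u), forall t, C (t *: e - u) -> 1 <= t
    & forall s, C (s *: e + u) -> 0 <= s].
Proof.
split=> [[Cu /(ounorm_eq1P Cu)[Ceu u1] /(ounorm_eq1P Ceu)[_ eu1]]|].
  split=> // s Cs; suff : 1 <= s + 1 by lra.
  by apply: eu1; rewrite unit_scale_sub_compl addrK.
move=> [Cu Ceu u1 u0]; split=> //; first exact/(ounorm_eq1P Cu).
apply/(ounorm_eq1P Ceu); rewrite subKr; split=> // t.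
by rewrite unit_scale_sub_compl => /u0; rewrite subr_ge0.
Qed.

Lemma periphery_compl (u : V) : periphery C e u -> periphery C e (e - u).
Proof.
move=> [Cu u1 eu1]; have [Ceu _] := (ounorm_eq1P Cu).1 u1.
by split=> //; rewrite subKr.
Qed.

(** [w] is [v] rescaled so that its optimal bounds become [0] and [1].  Bounds
    are handled as least shifts, so the optimal lower bound of [v] is [- m] and
    the length [d] of its optimal interval is the sum [M + m]. *)
Lemma exists_periphery (v : V) : ~ line e v ->
  exists w, periphery C e w /\ plane e w v.
Proof.
move=> vNe.
have e0 : e <> 0 by move=> e0; apply: vNe; exact: line_of_unit0.
have [m [Cm m_least]] := exists_least_shift v e0.
have [M [CM M_least]] := exists_least_shift (- v) e0.
pose d := M + m.
have dE : d *: e = (m *: e + v) + (M *: e - v).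
  by rewrite addrACA subrr addr0 -scalerDl addrC.
have d_ge0 : 0 <= d.
  by apply: (cone_unit_scale_ge0 e0); rewrite dE; exact: cone_addC.
have d_neq0 : d != 0.
  apply/eqP => d0; apply: vNe; exists (- m).
  (* The two optimal bounds coincide, so both differences vanish by
     properness. *)
  have /eqP : m *: e + v = 0.
    apply: (ous_proper Vous Cm).
    have /eqP := dE; rewrite d0 scale0r eq_sym addr_eq0 => /eqP ->.
    by rewrite opprK.
  by rewrite addrC addr_eq0 scaleNr => /eqP.
have d_gt0 : 0 < d by rewrite lt0r d_neq0.
pose w := d^-1 *: (m *: e + v).
have dw : d *: w = m *: e + v by rewrite scalerA divff // scale1r.
exists w; split; last first.
  by exists (- m), d; rewrite dw addrA -scalerDl addNr scale0r add0r.
apply/peripheryP; split.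
- by apply: cone_scaleC Cm; rewrite invr_ge0.
- have -> : e - w = d^-1 *: (M *: e - v).
    rewrite -{1}[e](scalerK (lt0r_neq0 d_gt0)) -scalerBr dE.
    by rewrite addrC addKr.
  by apply: cone_scaleC CM; rewrite invr_ge0.
- move=> t /(cone_scaleC d_ge0).
  rewrite scalerBr dw scalerA opprD addrA -scalerBl => /M_least.
  by rewrite lerBrDr -/d ler_pMr.
- move=> s /(cone_scaleC d_ge0).
  rewrite scalerDr dw scalerA addrA -scalerDl => /m_least.
  by rewrite lerDr pmulr_rge0.
Qed.

(** * Uniqueness of the periphery element of a plane *)

(** Since [0] and [1] are optimal for [w'] when [b > 0], the optimal bounds of
    [w] are [a] and [a + b]; but [0 <= w <= e]. *)
Lemma periphery_affine_bounds (w w' : V) (a b : R) :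
  periphery C e w -> periphery C e w' -> 0 < b -> w = a *: e + b *: w' ->
  0 <= a /\ a + b <= 1.
Proof.
move=> /peripheryP[Cw Cew _ _] /peripheryP[_ _ w'1 w'0] b0 wE.
have b1 : 0 <= b^-1 by rewrite invr_ge0 ltW.
split.
  move: Cw; rewrite wE => /(cone_scaleC b1).
  rewrite scalerDr !scalerA mulVf ?gt_eqF // scale1r => /w'0.
  by rewrite pmulr_rge0 // invr_gt0.
move: Cew; rewrite wE opprD addrA -{1}[e]scale1r -scalerBl => /(cone_scaleC b1).
rewrite scalerBr !scalerA mulVf ?gt_eqF // scale1r => /w'1.
by rewrite ler_pdivlMl // mulr1; lra.
Qed.

(** The bounds apply to the affine change and to its inverse, and together they
    leave only the identity. *)
Lemma periphery_affine_eq (w w' : V) (a b : R) :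
  periphery C e w -> periphery C e w' -> 0 < b -> w = a *: e + b *: w' ->
  w = w'.
Proof.
move=> Pw Pw' b0 wE.
have [a_ge0 ab1] := periphery_affine_bounds Pw Pw' b0 wE.
have w'E : w' = - (b^-1 * a) *: e + b^-1 *: w.
  rewrite wE scalerDr !scalerA mulVf ?gt_eqF // scale1r addrA -scalerDl.
  by rewrite addNr scale0r add0r.
have ib0 : 0 < b^-1 by rewrite invr_gt0.
have [a_le0 ab1'] := periphery_affine_bounds Pw' Pw ib0 w'E.
have a0 : a = 0.
  move: a_le0; rewrite oppr_ge0 pmulr_rle0 // => a_le0.
  by apply/eqP; rewrite eq_le a_le0.
have b1 : b = 1.
  move: ab1 ab1'; rewrite a0 mulr0 oppr0 !add0r invf_le1 // => b_le1 b_ge1.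
  by apply/eqP; rewrite eq_le b_le1.
by rewrite wE a0 b1 scale0r add0r scale1r.
Qed.

Lemma periphery_plane_unique (v w w' : V) :
  ~ line e v -> periphery C e w -> periphery C e w' ->
  plane e w v -> plane e w' v -> w' = w \/ w' = e - w.
Proof.
move=> vNe Pw Pw' [a [b vE]] [a' [b' vE']].
have b'0 : b' != 0.
  by apply/eqP => b0; apply: vNe; exists a'; rewrite vE' b0 scale0r addr0.
have b0 : b != 0.
  by apply/eqP => b0; apply: vNe; exists a; rewrite vE b0 scale0r addr0.
have w'E : w' = (b'^-1 * (a - a')) *: e + (b'^-1 * b) *: w.
  apply: (scalerI b'0); rewrite scalerDr !scalerA !mulrA divff // !mul1r.
  by rewrite scalerBl addrAC -vE vE' addrAC subrr add0r.
have : b'^-1 * b != 0 by rewrite mulf_neq0 ?invr_eq0.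
rewrite neq_lt => /orP[b_lt0|b_gt0]; [right|left].
- (* A negative slope is turned into a positive one by reflecting [w]. *)
  have b_gt0 : 0 < - (b'^-1 * b) by rewrite oppr_gt0.
  apply: (periphery_affine_eq (a := b'^-1 * (a - a') + b'^-1 * b)
    Pw' (periphery_compl Pw) b_gt0).
  by rewrite {1}w'E scalerBr !scaleNr opprK scalerDl addrA addrK.
- exact: periphery_affine_eq Pw' Pw b_gt0 w'E.
Qed.
End OrderUnitSpace.

Theorem theorem5p8 (R : realType) (V : lmodType R) (C : set V) (e : V)
    (Vous : order_unit_space C e) (dimV : dim_ge V 2) :
  [/\ [set: V] = \bigcup_(u in periphery C e) plane e u,
      dim_ge V 3 -> \bigcap_(u in periphery C e) plane e u = line e
    & forall v : V, ~ line e v ->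
        exists w : V,
          [/\ periphery C e w,
              plane e w v,
              plane e w = plane e (e - w)
            & forall w' : V, periphery C e w' -> plane e w' v ->
                w' = w \/ w' = e - w]].
Proof.
have line_plane v u : line e v -> plane e u v.
  by move=> [a ->]; exists a, 0; rewrite scale0r addr0.
split.
- apply/esym/seteqP; split=> // v _.
  have [ve|/(exists_periphery Vous)[w [Pw wv]]] := pselect (line e v).
    (* Every plane contains [v], so any periphery element serves; one exists
       because some vector lies off the line. *)
    have [x /(exists_periphery Vous)[w [Pw _]]] := exists_notin_line e dimV.
    by exists w => //; exact: line_plane.
  by exists w.
- move=> dim3; apply/seteqP; split=> [v vP|v ve u _]; last exact: line_plane.
  apply: contrapT => vNe.
  have [w [Pw wv]] := exists_periphery Vous vNe.
  have [x xNw] := exists_notin_plane e w dim3.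
  have [w' [Pw' w'x]] : exists w', periphery C e w' /\ plane e w' x.
    by apply: (exists_periphery Vous) => xe; apply: xNw; exact: line_plane.
  have [w'E|w'E] := periphery_plane_unique Vous vNe Pw Pw' wv (vP _ Pw').
    by apply: xNw; rewrite -w'E.
  by apply: xNw; rewrite -plane_compl -w'E.
- move=> v vNe; have [w [Pw wv]] := exists_periphery Vous vNe.
  exists w; split=> //; first by rewrite plane_compl.
  by move=> w' Pw' w'v; exact: (periphery_plane_unique Vous vNe Pw Pw' wv w'v).
Qed.
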